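(* Let $r,s\ge 3$ be integers with $r\equiv 2\pmod 4$ and $s\equiv 0\pmod 4$. Then $$ac(T_{r,s})=\frac{1}{8}\left(r^2s+rs^2+2rs-2r-2s-4\right).$$
   Context: $T_{r,s}=C_r\square C_s$ is the toroidal grid, the Cartesian product of the cycles on $r$ and $s$ vertices ($r,s\ge3$): vertices are pairs $(i,j)$ with $0\le i\le r-1$, $0\le j\le s-1$, and two vertices are adjacent iff they agree in one coordinate and the other coordinates are adjacent in the corresponding cycle. For a connected graph $G$ with diameter $d\ge 2$ and graph distance $d(u,v)$, an antipodal coloring is a map $g$ from $V(G)$ to the non-negative integers with $|g(u)-g(v)|\ge d-d(u,v)$ for all distinct vertices $u,v$. The span of $g$ is the largest integer assigned by $g$, and the antipodal number $ac(G)$ is the minimum span among all antipodal colorings of $G$. *)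

(* Defs.v *)
From mathcomp Require Import all_boot all_order all_algebra.

Set Implicit Arguments.
Unset Strict Implicit.
Unset Printing Implicit Defensive.

Section Distance.
Variables (T : finType) (e : rel T).

Definition walk_of_length (n : nat) (x y : T) : bool :=
  [exists p : n.-tuple T, path e x p && (last x p == y)].

(* Shortest walks visit no vertex twice, so lengths below #|T| suffice; the
   junk value #|T| is taken exactly when y is not reachable from x. *)
Definition gdist (x y : T) : nat :=
  \big[minn/#|T|]_(n < #|T| | walk_of_length n x y) n.

Definition diam : nat := \max_(x : T) \max_(y : T) gdist x y.

Lemma gdist_le x (p : seq T) : path e x p -> gdist x (last x p) <= size p.
Proof.
case/shortenP => p' e_p' Up' sub.
have lt_p' : size p' < #|T| by have /card_uniqP /= <- := Up'; apply: max_card.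
have le_p' : size p' <= size p.
  by apply: uniq_leq_size sub; case/andP: Up'.
apply: leq_trans le_p'; rewrite /gdist.
have w : walk_of_length (Ordinal lt_p') x (last x p').
  by apply/existsP; exists (in_tuple p'); rewrite e_p' eqxx.
have := mem_index_enum (Ordinal lt_p').
elim: (index_enum _) => // i l IH; rewrite inE big_cons.
case/predU1P => [<-|/IH le_l]; first by rewrite w geq_minl.
by case: ifP => // _; rewrite geq_min le_l orbT.
Qed.

Lemma gdist_path x y :
  connect e x y -> exists p, [/\ path e x p, last x p = y & size p = gdist x y].
Proof.
move=> /connectP[q e_q ->].
have : gdist x (last x q) < #|T|.
  case/shortenP: e_q => p' e_p' Up' _; apply: leq_ltn_trans (gdist_le e_p') _.
  by have /card_uniqP /= <- := Up'; apply: max_card.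
have [->|[n wn ->]] : gdist x (last x q) = #|T| \/
    (exists2 n, walk_of_length n x (last x q) & gdist x (last x q) = n).
- rewrite /gdist; elim/big_ind: _ => [|a b Ha Hb|i Hi]; first by left.
    by case: (leqP a b).
  by right; exists i.
- by rewrite ltnn.
move=> _; case/existsP: wn => p /andP[e_p /eqP lp].
by exists p; rewrite lp size_tuple.
Qed.

Lemma leq_gdist_diam x y : gdist x y <= diam.
Proof.
apply: leq_trans (leq_bigmax (F := fun x => \max_y gdist x y) x).
exact: leq_bigmax.
Qed.

End Distance.

Section Antipodal.
Variables (T : finType) (e : rel T).

(* The subtraction is never truncated, by leq_gdist_diam; `|_ - _| is the
   distance on nat, not a truncated difference. *)
Definition antipodal_coloring (g : T -> nat) : bool :=
  [forall u, forall v, (u != v) ==> (diam e - gdist e u v <= `|g u - g v|)].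

Definition span (g : T -> nat) : nat := \max_(u : T) g u.

(* A coloring of span k takes its values in 'I_k.+1. *)
Definition antipodal_span (k : nat) : bool :=
  [exists g : {ffun T -> 'I_k.+1},
     antipodal_coloring (fun u => g u) && (span (fun u => g u) == k)].

Lemma antipodal_spanP k :
  reflect (exists2 g : T -> nat, antipodal_coloring g & span g = k)
          (antipodal_span k).
Proof.
apply: (iffP existsP) => [[g /andP[cg /eqP sg]]|[g cg sg]].
  by exists (fun u => nat_of_ord (g u)).
have gE u : [ffun u => inord (g u) : 'I_k.+1] u = g u :> nat.
  by rewrite ffunE inordK // ltnS -sg; apply: leq_bigmax.
exists [ffun u => inord (g u)]; apply/andP; split.
  apply/forallP => u; apply/forallP => v; rewrite !gE.
  by move/forallP: cg => /(_ u)/forallP.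
by apply/eqP; rewrite -[RHS]sg; apply: eq_bigr => u _; apply: gE.
Qed.

Lemma antipodal_span_ex : exists k, antipodal_span k.
Proof.
pose g (u : T) := diam e * enum_rank u.
exists (span g); apply/antipodal_spanP; exists g => //.
apply/forallP => u; apply/forallP => v; apply/implyP => uv.
apply: leq_trans (leq_subr _ _) _.
have : (enum_rank u : nat) != enum_rank v.
  by apply: contraNneq uv => /val_inj/enum_rank_inj ->.
rewrite /g; move: (enum_rank u : nat) (enum_rank v : nat) => a b {uv}.
wlog ab : a b / a < b => [H ne_ab|_].
  case: (ltnP a b) => [lt_ab|le_ba]; first exact: H.
  have ne_ba : b != a by rewrite eq_sym.
  by rewrite distnC; apply: H; rewrite // ltn_neqAle ne_ba.
rewrite distnEr ?leq_mul2l ?(ltnW ab) ?orbT // -mulnBr.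
by rewrite leq_pmulr ?subn_gt0.
Qed.

Definition antipodal_number : nat := ex_minn antipodal_span_ex.

Lemma antipodal_number_attained :
  exists2 g, antipodal_coloring g & span g = antipodal_number.
Proof. by apply/antipodal_spanP; rewrite /antipodal_number; case: ex_minnP. Qed.

Lemma antipodal_number_min g : antipodal_coloring g -> antipodal_number <= span g.
Proof.
move=> cg; rewrite /antipodal_number; case: ex_minnP => k _; apply.
by apply/antipodal_spanP; exists g.
Qed.

End Antipodal.

(* The (simple) cycle on n >= 3 vertices; ordS is the successor modulo n. *)
Definition cycle_graph (n : nat) : rel 'I_n :=
  fun i j => (j == ordS i) || (i == ordS j).

Definition box_product (T1 T2 : finType) (e1 : rel T1) (e2 : rel T2) :
    rel (T1 * T2)%type :=
  fun u v => (u.1 == v.1) && e2 u.2 v.2 || (u.2 == v.2) && e1 u.1 v.1.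

Definition torus (r s : nat) : rel ('I_r * 'I_s)%type :=
  box_product (@cycle_graph r) (@cycle_graph s).

(* Main.v *)
Require Import Defs.
From mathcomp Require Import all_boot all_order all_algebra.
From mathcomp Require Import zify ring.

Set Implicit Arguments.
Unset Strict Implicit.
Unset Printing Implicit Defensive.

Import Order.TTheory GRing.Theory Num.Theory.
Local Open Scope ring_scope.

(** Write r = 2p and s = 2q with p = 2a + 1 and q = 2h. The torus has diameter
    d = p + q, which is odd; put D = (d + 1) / 2 = a + h + 1. Up to arithmetic
    the claim is that the antipodal number is D (2pq - 1), where 4pq is the
    number of vertices.

    Lower bound ([span_torus_ge]). On a cycle of length 2p the three distances
    between three vertices add up to at most 2p, since they are realised inside
    one turn of the cycle; so three vertices of the torus have distances adding
    up to at most 2d. Their three pairwise colour gaps therefore add up to at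
    least 3d - 2d = d. But this sum is twice the largest gap, and d is odd, so
    the largest gap is at least D: any D consecutive colours are used on at
    most two vertices, and 4pq vertices need 2pq blocks of D colours, the last
    of which may be reduced to its first colour.

    Upper bound ([pair_coloringP]). Colour the vertices by antipodal pairs,
    the k-th pair receiving D k. This is an antipodal
    colouring as soon as vertices of consecutive pairs are at distance at least
    d - D = a + h; pairs further apart in the list differ by at least 2D > d in
    colour. The antipodal pairs are the elements of the abelian group
    G = (Z/2p x Z/2q) / <(p, q)>, of order 2pq, and what is needed is a
    Hamiltonian path in G with steps of small enough length. Take steps
    alpha = (a, h), of length a + h = d - D, and alpha + (0, 1), of length D:
    the antipode of a vertex at distance d - D or D is at distance D or d - D,
    so both elements of a pair are far enough. Modulo (p, q) one finds
    p alpha = (0, h), so alpha has order 4p and its cosets in G are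
    represented by (0, t) with 0 <= t < h. The path runs through
    l alpha + (0, t), for l from 0 to 4p - 1, and passes from t to t + 1 with
    the second step, because 4p alpha = 0. The position 4p t + l of the pair of
    (i, j) can be read off explicitly: t is the residue of j modulo h, and
    l = p (j / h) - 2 i modulo 4p, because -2a = 1 modulo p. *)

(** * Graph distances *)

Section GraphDistance.
Local Open Scope nat_scope.
Variables (T : finType) (e : rel T) (f : T -> T -> nat).
Hypothesis f_refl : forall x, f x x = 0.
Hypothesis f_edge : forall x y z, e x y -> f x z <= (f y z).+1.
Hypothesis f_descent :
  forall x z, x != z -> exists2 y, e x y & f x z = (f y z).+1.

(** A function that drops by at most one along an edge is a lower bound for the
    length of any path, and following its steepest descent gives a path of
    that very length. *)
Lemma gdist_eq x z : gdist e x z = f x z.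
Proof.
have [p [e_p lp sp]] : exists p, [/\ path e x p, last x p = z & size p = f x z].
  move: {2}(f x z) (erefl (f x z)) => n; elim: n x => [|n IHn] x.
    have [->|/f_descent[y _ ->]//] := eqVneq x z.
    by exists [::]; rewrite f_refl.
  have [->|/f_descent[y exy ->] [/IHn[p [e_p lp sp]]]] := eqVneq x z.
    by rewrite f_refl.
  by exists (y :: p); rewrite /= exy sp.
apply/eqP; rewrite eqn_leq; apply/andP; split.
  by rewrite -sp -lp; apply: gdist_le.
have /gdist_path[q [e_q lq <-]] : connect e x z by apply/connectP; exists p.
elim: q x e_q lq {p e_p lp sp} => [|y q IHq] x /= => [_ <-|/andP[exy e_q] lq].
  by rewrite f_refl.
by apply: leq_trans (f_edge z exy) _; rewrite ltnS; apply: IHq.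
Qed.

End GraphDistance.

(** * Distances in cycles and tori *)

Section TorusDistance.
Local Open Scope nat_scope.

Definition cdist (n i j : nat) : nat := minn `|i - j| (n - `|i - j|).

Lemma cdistC n i j : cdist n i j = cdist n j i.
Proof. by rewrite /cdist distnC. Qed.

Lemma val_ordS n (i : 'I_n) : ordS i = (if i.+1 == n then 0 else i.+1) :> nat.
Proof.
rewrite /=; case: eqP => [->|ni]; first exact: modnn.
by rewrite modn_small //; have := ltn_ord i; lia.
Qed.

Lemma cdist_edge n (i j k : 'I_n) :
  cycle_graph i j -> cdist n i k <= (cdist n j k).+1.
Proof.
rewrite /cdist; have := (ltn_ord i, ltn_ord j, ltn_ord k) => -[[i_n j_n] k_n].
by case/orP=> /eqP/(congr1 val); rewrite [RHS]val_ordS /=; case: eqP; lia.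
Qed.

(** Among the two neighbours of i, one goes along a shortest arc to k. *)
Lemma cdist_descent n (i k : 'I_n) :
  i != k -> exists2 j, cycle_graph i j & cdist n i k = (cdist n j k).+1.
Proof.
move=> ik; have {ik} : i <> k :> nat by move/val_inj/eqP; apply/negP.
rewrite /cdist; have := (ltn_ord i, ltn_ord k) => -[i_n k_n] ik.
(* The length of the arc from i to k in the direction of the successor. *)
pose up := if i < k then k - i else n + k - i.
have [up_small|up_large] := leqP up.*2 n.
  exists (ordS i); first by rewrite /cycle_graph eqxx.
  by rewrite val_ordS; move: up_small; rewrite /up; do 2!case: ifP; lia.
have dn_n : (if i == 0 :> nat then n.-1 else i.-1) < n by case: ifP; lia.
have dnE : i = ordS (Ordinal dn_n).
  by apply/val_inj; rewrite [RHS]val_ordS /=; do 2!case: ifP; lia.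
exists (Ordinal dn_n); first by rewrite /cycle_graph -dnE eqxx orbT.
by rewrite /=; move: up_large; rewrite /up; do 2!case: ifP; lia.
Qed.

Lemma gdist_torus r s (u v : 'I_r * 'I_s) :
  gdist (@torus r s) u v = cdist r u.1 v.1 + cdist s u.2 v.2.
Proof.
pose f (u v : 'I_r * 'I_s) := cdist r u.1 v.1 + cdist s u.2 v.2.
apply: (@gdist_eq _ _ f) => {u v} [u|u v w|u w]; rewrite /f.
- by rewrite /cdist !distnn !min0n.
- case/orP=> /andP[/eqP-> uv].
    by rewrite -addnS leq_add2l cdist_edge.
  by rewrite -addSn leq_add2r cdist_edge.
case: u w => [i j] [i' j']; have [->|ii' _] := eqVneq i i'.
  have [->|/cdist_descent[k jk jE] _] := eqVneq j j'; first by rewrite eqxx.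
  by exists (i', k); rewrite ?jE ?addnS // /torus /box_product /= eqxx jk.
have [k ik iE] := cdist_descent ii'.
by exists (k, j); rewrite /= ?iE // /torus /box_product /= eqxx ik orbT.
Qed.

Lemma diam_torus p q : 0 < p -> 0 < q -> diam (@torus p.*2 q.*2) = p + q.
Proof.
move=> p_gt0 q_gt0; apply/eqP; rewrite eqn_leq; apply/andP; split.
  apply/bigmax_leqP => u _; apply/bigmax_leqP => v _.
  by rewrite gdist_torus /cdist; lia.
have [p2 q2 p2' q2'] : [/\ 0 < p.*2, 0 < q.*2, p < p.*2 & q < q.*2] by split; lia.
apply: leq_trans (leq_gdist_diam _ (Ordinal p2, Ordinal q2)
                                   (Ordinal p2', Ordinal q2')).
by rewrite gdist_torus /cdist /=; lia.
Qed.

(** Three points cut the cycle into three arcs, each at least as long as the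
    distance between its ends. *)
Lemma cdist_perimeter p (i j k : 'I_p.*2) :
  cdist p.*2 i j + cdist p.*2 j k + cdist p.*2 i k <= p.*2.
Proof.
by rewrite /cdist; have := (ltn_ord i, ltn_ord j, ltn_ord k) => -[[]]; lia.
Qed.

End TorusDistance.

(** * The lower bound *)

Section LowerBound.
Local Open Scope nat_scope.

Lemma card_le_fibers (T : finType) (g : T -> nat) m K :
  (forall x, g x < K) -> (forall k, #|[pred x | g x == k]| <= m) ->
  #|T| <= K * m.
Proof.
move=> gK fib_m; rewrite -sum1_card.
rewrite (partition_big (fun x => Ordinal (gK x)) predT) //=.
rewrite -[K in K * _]card_ord -sum_nat_const; apply: leq_sum => k _.
by apply: leq_trans (fib_m k); rewrite sum1_card.
Qed.

(** The fibres of [g u %/ D] are the blocks of D consecutive colours; the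
    hypothesis on D says that the diameter p + q is odd. *)
Lemma span_torus_ge p q D (g : 'I_p.*2 * 'I_q.*2 -> nat) :
  0 < p -> 0 < q -> p + q = D.*2.-1 ->
  antipodal_coloring (@torus p.*2 q.*2) g -> D * (p * q).*2.-1 <= Defs.span g.
Proof.
move=> p_gt0 q_gt0 dD cg.
have D_gt0 : 0 < D by lia.
have fib2 k : #|[pred u | g u %/ D == k]| <= 2.
  rewrite leqNgt; apply/negP => /card_gt2P[u [v [w [[]]]]].
  rewrite !inE => /eqP uk /eqP vk /eqP wk [uv vw wu].
  have diff (x y : 'I_p.*2 * 'I_q.*2) : x != y ->
      p + q <= cdist p.*2 x.1 y.1 + cdist q.*2 x.2 y.2 + `|g x - g y|.
    move=> xy; have /forallP/(_ x)/forallP/(_ y) := cg.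
    by rewrite xy diam_torus // gdist_torus leq_subLR.
  (* Gaps inside a block add up to at most 2 (D - 1) < p + q, while distances
     add up to at most 2 (p + q). *)
  have := (diff _ _ uv, diff _ _ vw, diff u w); rewrite eq_sym wu.
  move=> -[[duv dvw] /(_ isT) duw].
  have := (cdist_perimeter u.1 v.1 w.1, cdist_perimeter u.2 v.2 w.2) => -[t1 t2].
  move: (divn_eq (g u) D) (divn_eq (g v) D) (divn_eq (g w) D).
  move: (ltn_pmod (g u) D_gt0) (ltn_pmod (g v) D_gt0) (ltn_pmod (g w) D_gt0).
  rewrite uk vk wk.
  move: (g u %% D) (g v %% D) (g w %% D) (k * D) => ru rv rw c ru_lt rv_lt rw_lt.
  move=> gu gv gw; rewrite {}gu {}gv {}gw !distnDl in duv dvw duw.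
  by move: duv dvw duw t1 t2; do 6![move: (cdist _ _ _) => ?]; lia.
have gK u : g u %/ D < (Defs.span g %/ D).+1.
  by rewrite ltnS leq_div2r //; apply: leq_bigmax.
have := card_le_fibers gK fib2; rewrite card_prod !card_ord => NK.
rewrite mulnC -leq_divRL //; nia.
Qed.

End LowerBound.

(** * The optimal colouring *)

Section UpperBound.
Local Open Scope nat_scope.
Variables (a h : nat).
Hypothesis h_gt0 : 0 < h.
(* These are half the side lengths: p is odd because r = 2 modulo 4, and q is
   even because s = 0 modulo 4. *)
Let p := a.*2.+1.
Let q := h.*2.
Let D := a + h + 1.

(** The position of the antipodal pair of u along the Hamiltonian path. The
    summand [(p.*2 - u.1).*2] stands for - 2 i modulo 4p. *)
Definition pair_index (u : 'I_p.*2 * 'I_q.*2) : nat :=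
  4 * p * (u.2 %% h) + (p * (u.2 %/ h) + (p.*2 - u.1).*2) %% (4 * p).

Lemma pair_index_lt u : pair_index u < (p * q).*2.
Proof.
have := ltn_pmod u.2 h_gt0.
have : (p * (u.2 %/ h) + (p.*2 - u.1).*2) %% (4 * p) < 4 * p.
  by rewrite ltn_pmod.
by rewrite /pair_index /q; nia.
Qed.

(** All quotients and remainders in [pair_index u] at once. The bound on c holds
    because p y + 4p - 2 i <= 7p. *)
Variant pair_index_spec (u : 'I_p.*2 * 'I_q.*2) : nat -> Prop :=
  PairIndexSpec t y l c of t < h & y < 4 & l < 4 * p & c < 2
    & u.2 = y * h + t :> nat & p * y + 4 * p = u.1.*2 + c * (4 * p) + l
    : pair_index_spec u (4 * p * t + l).

Lemma pair_indexP u : pair_index_spec u (pair_index u).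
Proof.
have [i_lt j_lt] := (ltn_ord u.1, ltn_ord u.2).
have y_lt : u.2 %/ h < 4 by rewrite ltn_divLR //; move: j_lt; rewrite /q; lia.
rewrite /pair_index; set n := p * _ + _.
have n_lt : n < 2 * (4 * p) by rewrite /n; move: i_lt y_lt; nia.
apply: (@PairIndexSpec _ _ (u.2 %/ h) _ (n %/ (4 * p))).
- exact: ltn_pmod.
- exact: y_lt.
- exact: ltn_pmod.
- by rewrite ltn_divLR.
- exact: divn_eq.
by rewrite -addnA -divn_eq /n; lia.
Qed.

Lemma divmod_inj m t l t' l' : l < m -> l' < m ->
  m * t + l = m * t' + l' -> t = t' /\ l = l'.
Proof.
move=> l_m l'_m E; have m_gt0 : 0 < m by lia.
have := (congr1 (divn^~ m) E, congr1 (modn^~ m) E) => /=.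
rewrite ![m * _]mulnC !divnMDl // !modnMDl !modn_small // !divn_small //.
by rewrite !addn0 => -[].
Qed.

(** Both cases of interest come from subtracting the equations of
    [pair_index_spec]. Here w is the difference of the quotients by h, e that
    of the remainders, and z counts the turns modulo 4p; e = 1 can only
    happen when the path enters a new coset of alpha. *)
Lemma pair_index_diff u v (b : bool) : pair_index v = pair_index u + b ->
  exists w z e : int, [/\ -3 <= w <= 3, -2 <= z <= 1, 0 <= e <= b%:Z,
    v.2%:Z - u.2%:Z = w * h%:Z + e &
    2 * (v.1%:Z - u.1%:Z) + b%:Z = p%:Z * (w - 4 * z)]%R.
Proof.
case: u v => [i j] [i' j'].
case: pair_indexP => t' y' l' c' th' y4' lp' c2' /= jE' iE'.
case: pair_indexP => t y l c th y4 lp c2 /= jE iE diffE.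
have [t'_le [k [k2 l'E]]] : t <= t' <= t + b /\
    exists k, k < 2 /\ l' + k * (4 * p) = l + b.
  rewrite -addnA in diffE; have [lb_lt|lb_ge] := ltnP (l + b) (4 * p).
    have [-> ->] := divmod_inj lp' lb_lt diffE.
    by split; [lia | exists 0; lia].
  (* The last vertex of a coset, l = 4p - 1, followed by the first of the next. *)
  have [] := @divmod_inj (4 * p) t' l' t.+1 0; try by lia.
  by move=> -> ->; split; [lia | exists 1; lia].
exists (y'%:Z - y%:Z)%R, (c'%:Z - c%:Z - k%:Z)%R, (t'%:Z - t%:Z)%R.
by split; try lia; nia.
Qed.

(** In [pair_index_diff] for b = false, 2 (i' - i) = p (w - 4 z) and
    j' - j = w h. As p is odd, w is even: w = 0 gives the same vertex and
    w = 2 or -2 gives the shift by (p, q). *)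
Lemma pair_index_eq u v : pair_index u = pair_index v -> u != v ->
  cdist p.*2 u.1 v.1 + cdist q.*2 u.2 v.2 = p + q.
Proof.
case: u v => [i j] [i' j'] idx_uv /negP uv.
have {uv} : ~ (i = i' :> nat /\ j = j' :> nat).
  by move=> [/val_inj ii' /val_inj jj']; apply: uv; rewrite ii' jj'.
have [|w [z [e []]]] := @pair_index_diff (i, j) (i', j') false; first by lia.
rewrite /cdist /=; move: (ltn_ord i) (ltn_ord i').
move: (i : nat) (i' : nat) (j : nat) (j' : nat) => {idx_uv}{}i {}i' {}j {}j'.
move=> i_lt i'_lt w_b z_b e_b jE iE ij; rewrite /p /q in i_lt i'_lt iE *.
have z_in : (z = -2 \/ z = -1 \/ z = 0 \/ z = 1)%R by lia.
have w_in : (w = -3 \/ w = -2 \/ w = -1 \/ w = 0 \/ w = 1 \/ w = 2 \/ w = 3)%R.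
  by lia.
(* Fixing w and z makes the two equations linear in i, j, a, h and e. *)
by move: jE iE {w_b z_b}; case: z_in => [->|[->|[->|->]]];
  case: w_in => [->|[->|[->|[->|[->|[->|->]]]]]]; lia.
Qed.

(** In [pair_index_diff] for b = true, 2 (i' - i) + 1 = p (w - 4 z)
    forces w to be odd. If w is 1 or -3 then i' - i = a modulo 2p, and j' - j is h or h + 1 modulo 2q; if w
    is -1 or 3 then i' - i = - (a + 1) modulo 2p, and j' - j is -h or 1 - h
    modulo 2q. *)
Lemma pair_index_succ u v : pair_index v = (pair_index u).+1 ->
  a + h <= cdist p.*2 u.1 v.1 + cdist q.*2 u.2 v.2.
Proof.
rewrite -addn1 => /(@pair_index_diff u v true)[w [z [e []]]].
rewrite /cdist; move: (ltn_ord u.1) (ltn_ord v.1).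
move: (u.1 : nat) (v.1 : nat) (u.2 : nat) (v.2 : nat) => i i' j j'.
move=> i_lt i'_lt w_b z_b e_b jE iE; rewrite /p /q in i_lt i'_lt iE *.
have z_in : (z = -2 \/ z = -1 \/ z = 0 \/ z = 1)%R by lia.
have w_in : (w = -3 \/ w = -2 \/ w = -1 \/ w = 0 \/ w = 1 \/ w = 2 \/ w = 3)%R.
  by lia.
(* Fixing w and z makes the two equations linear in i, j, a, h and e. *)
by move: jE iE {w_b z_b}; case: z_in => [->|[->|[->|->]]];
  case: w_in => [->|[->|[->|[->|[->|[->|->]]]]]]; lia.
Qed.

Definition pair_coloring u := D * pair_index u.

Lemma pair_coloringP : antipodal_coloring (@torus p.*2 q.*2) pair_coloring.
Proof.
apply/forallP => u; apply/forallP => v; apply/implyP => uv.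
rewrite diam_torus; try by rewrite /p /q; lia.
rewrite gdist_torus leq_subLR /pair_coloring.
wlog le_uv : u v uv / pair_index u <= pair_index v => [H|].
  have [|/ltnW] := leqP (pair_index u) (pair_index v); first exact: H.
  by rewrite (cdistC _ u.1) (cdistC _ u.2) distnC; apply: H; rewrite // eq_sym.
rewrite distnEr ?leq_mul2l ?le_uv ?orbT // -mulnBr.
have [uvE|lt_uv] := leqP (pair_index v) (pair_index u).
  have /pair_index_eq/(_ uv)-> : pair_index u = pair_index v by lia.
  exact: leq_addr.
have [le_vS|lt_uSv] := leqP (pair_index v) (pair_index u).+1.
  have vS : pair_index v = (pair_index u).+1 by lia.
  by have := pair_index_succ vS; rewrite vS subSnn muln1 /p /q /D; lia.
apply: leq_trans (leq_addl _ _).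
apply: leq_trans (_ : D * 2 <= _); first by rewrite /p /q /D; lia.
by rewrite leq_mul2l; apply/orP; right; lia.
Qed.

Lemma span_pair_coloring_le : Defs.span pair_coloring <= D * (p * q).*2.-1.
Proof.
apply/bigmax_leqP => u _; rewrite leq_mul2l; apply/orP; right.
by have := pair_index_lt u; lia.
Qed.

End UpperBound.

Theorem theorem4p3 (r s : nat) (hr : (3 <= r)%N) (hs : (3 <= s)%N)
    (hr4 : (r = 2 %[mod 4])%N) (hs4 : (s = 0 %[mod 4])%N) :
  (antipodal_number (@torus r s))%:R =
    1 / 8%:R * (r%:R ^+ 2 * s%:R + r%:R * s%:R ^+ 2 + 2%:R * r%:R * s%:R
                - 2%:R * r%:R - 2%:R * s%:R - 4%:R) :> rat.
Proof.
have [a rE] : exists a, r = (a.*2.+1).*2 by exists (r %/ 4)%N; lia.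
have [h sE] : exists h, s = (h.*2).*2 by exists (s %/ 4)%N; lia.
have h_gt0 : (0 < h)%N by lia.
rewrite {}rE {}sE {r s hr hs hr4 hs4}.
have -> : antipodal_number (@torus (a.*2.+1).*2 (h.*2).*2)
          = ((a + h + 1) * (a.*2.+1 * h.*2).*2.-1)%N.
  apply/eqP; rewrite eqn_leq; apply/andP; split.
    apply: leq_trans (span_pair_coloring_le a h_gt0).
    exact/antipodal_number_min/pair_coloringP.
  have [g cg <-] := antipodal_number_attained (@torus (a.*2.+1).*2 (h.*2).*2).
  by apply: span_torus_ge => //; lia.
(* The predecessor has to be a genuine subtraction before casting to rat. *)
rewrite -subn1 natrM natrB; last by nia.
rewrite -!mul2n !(natrM, natrD) -!natr1 !natrM.
by field.
Qed.
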